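(* Let $p=Y_i\bowtie Y_j$ be an X-point with auxiliary function $Y$, let $\Omega=[Y_i,Y_j;Y]$ be the corresponding triad, let $\lambda$ be the homology determined by $\Omega$ and $\mu$ the associated M\''obius transformation. If $p$ is regular (that is, both $Y_i$ and $Y_j$ are affine near $p$), then the homology $\lambda$ is harmonic, and hence the associated function $\mu$ is an involution.
   Context: All functions are piecewise-affine continuous real functions of one variable with rational coefficients and finitely many pieces on any interval. If two such functions satisfy $(p-\epsilon,p+\epsilon)\cap\{x\in\mathbb{Q}:Y_i(x)=Y_j(x)\}=\{p\}$ for some $\epsilon>0$ and $p\in\mathbb{Q}$, we write $p=Y_i\bowtie Y_j$ and call $p$ an X-point (the symbol $p$ also denotes the point $(p,Y_i(p))$). An auxiliary function $Y$ is a piecewise-affine function not through $(p,Y_i(p))$, here lying above it. All three functions are affine near $p$ on each side of $p$. The triad $\Omega=[Y_i,Y_j;Y]$ is identified with $[U,L;Y]$, $U=\max\{Y_i,Y_j\}$, $L=\min\{Y_i,Y_j\}$, and near $p$ one writes $[U,L;Y]=[I,J;K]$ for $x\geqslant p$ and $[U,L;Y]=[I',J';K']$ for $x<p$, with $I,J,K,I',J',K'$ affine functions (so near $p$, $J<I<K$ for $x>p$ and $J'<I'<K'$ for $x<p$). Identify $(x,y)\in\mathbb{Q}^2$ with $(x,y,1)\in\mathbb{P}^2(\mathbb{Q})$, let $o_\infty=(0,1,0)$, and let the symbol of an affine function also denote its graph (a line). The homology $\lambda$ determined by $\Omega$ is the projective collineation fixing $o_\infty$ and mapping the lines $I,J,K$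 to $I',J',K'$ respectively; it is a homology, i.e. it has a line of fixed points, the axis $P=po_\infty$, and an additional fixed point $o$ (the centre) not on $P$. The associated M\''obius transformation is $\mu=\left(\frac{K'-I'}{K'-J'}\right)^{-1}\circ\frac{K-I}{K-J}$ (inverse as a M\''obius map), which describes the action of $\lambda$ on abscissae, i.e. on the lines through $o_\infty$. The homology $\lambda$ is harmonic if, for any point $x$ (distinct from $o$ and not on $P$) with image $x'$, the harmonic conjugate of $o$ with respect to $x$ and $x'$ is the intersection of the line $xx'$ with $P$. *)

(* Defs.v *)
(* Mathematical Components and MathComp-Analysis. *)
From HB Require Import structures.
From mathcomp Require Import all_boot all_order all_algebra.
From mathcomp Require Import all_classical all_reals all_analysis.

Set Implicit Arguments.
Unset Strict Implicit.
Unset Printing Implicit Defensive.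

Import Order.TTheory GRing.Theory Num.Theory.
Import numFieldNormedType.Exports.

Local Open Scope classical_set_scope.
Local Open Scope ring_scope.

(* The affine function x |-> a x + b with rational coefficients is the pair
   (a, b), so that differences of affine functions are differences of pairs. *)
Notation affine := (rat * rat)%type.

Definition aff_rat (A : affine) (x : rat) : rat := A.1 * x + A.2.

Definition aff_real (R : realType) (A : affine) (x : R) : R :=
  ratr A.1 * x + ratr A.2.

(* a :: s are the endpoints of the pieces of f on [a, b]. *)
Definition piecewise_affine (R : realType) (f : R -> R) : Prop :=
  continuous f /\
  forall a b : R, a < b -> exists s : seq R,
    [/\ path <%R a s, last a s = b &
        forall i : nat, (i < size s)%N -> exists A : affine,
          forall x : R, nth b (a :: s) i <= x <= nth b s i ->
            f x = aff_real A x].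

Definition Xpoint (R : realType) (Yi Yj : R -> R) (p : rat) : Prop :=
  exists2 e : R, 0 < e &
    [set` `](ratr p - e), (ratr p + e)[ ] `&`
      [set x : R | (exists q : rat, x = ratr q) /\ Yi x = Yj x]
    = [set ratr p].

Definition auxiliary (R : realType) (Yi Y : R -> R) (p : rat) : Prop :=
  piecewise_affine Y /\ Yi (ratr p) < Y (ratr p).

(* [U, L; Y] = [I, J; K] on the right of p, and [I', J'; K'] on the left. *)
Definition triad_near (R : realType) (Yi Yj Y : R -> R) (p : rat)
    (I J K I' J' K' : affine) : Prop :=
  let U := Yi \max Yj in
  let L := Yi \min Yj in
  \forall x \near nbhs (ratr p : R),
    (ratr p <= x ->
       [/\ U x = aff_real I x, L x = aff_real J x & Y x = aff_real K x]) /\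
    (x < ratr p ->
       [/\ U x = aff_real I' x, L x = aff_real J' x & Y x = aff_real K' x]).

Definition affine_near (R : realType) (f : R -> R) (p : rat) : Prop :=
  exists A : affine, \forall x \near nbhs (ratr p : R), f x = aff_real A x.

Definition Xpoint_regular (R : realType) (Yi Yj : R -> R) (p : rat) : Prop :=
  affine_near Yi p /\ affine_near Yj p.

(* Projective geometry of P^2(Q) in homogeneous coordinates: a point is a
   nonzero row vector, a line is a matrix of rank 2, both seen through their
   row space; incidence, join, meet and equality are those of row spaces.
   A projective collineation is an invertible matrix acting on the right. *)
Definition hpoint (x y z : rat) : 'rV[rat]_3 := \row_(i < 3) [:: x; y; z]`_i.

Definition o_infty : 'rV[rat]_3 := hpoint 0 1 0.

(* The line a x - y + b z = 0, whose affine points are (x, a x + b, 1). *)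
Definition graph (A : affine) : 'M[rat]_3 := kermx (hpoint A.1 (-1) A.2)^T.

Definition fixes (lam : 'M[rat]_3) (x : 'rV[rat]_3) : Prop :=
  (x *m lam == x)%MS.

Definition triad_homology (I J K I' J' K' : affine) (lam : 'M[rat]_3) : Prop :=
  [/\ lam \in unitmx, fixes lam o_infty,
      (graph I *m lam == graph I')%MS,
      (graph J *m lam == graph J')%MS &
      (graph K *m lam == graph K')%MS].

(* The identity collineation is not a homology. *)
Definition homology (lam P : 'M[rat]_3) (o : 'rV[rat]_3) : Prop :=
  [/\ lam \in unitmx /\ ~~ is_scalar_mx lam,
      \rank P = 2%N,
      forall x : 'rV[rat]_3, x != 0 -> (x <= P)%MS -> fixes lam x,
      o != 0 /\ fixes lam o &
      ~~ (o <= P)%MS].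

(* o and q lie on the line joining the distinct points x and x', none of them
   being x or x', and the cross-ratio (x, x'; o, q) is -1. *)
Definition harmonic_conjugate (x x' o q : 'rV[rat]_3) : Prop :=
  \rank (x + x')%MS = 2%N /\
  exists a b c d : rat,
    [/\ o = a *: x + b *: x', q = c *: x + d *: x',
        [&& a != 0, b != 0, c != 0 & d != 0] & (b / a) / (d / c) = -1].

Definition harmonic_homology (lam P : 'M[rat]_3) (o : 'rV[rat]_3) : Prop :=
  homology lam P o /\
  forall x : 'rV[rat]_3,
    x != 0 -> ~~ (x == o)%MS -> ~~ (x <= P)%MS ->
    let x' := x *m lam in
    exists2 q : 'rV[rat]_3,
      (q == (x + x') :&: P)%MS & harmonic_conjugate x x' o q.

(* The matrix of the Moebius map A / B. *)
Definition quot_mx (A B : affine) : 'M[rat]_2 :=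
  \matrix_(i < 2, j < 2)
    let C := if i == 0 then A else B in if j == 0 then C.1 else C.2.

(* Action on P^1(Q), with None the point at infinity; this is a Moebius map
   for M invertible. *)
Definition moebius (M : 'M[rat]_2) (z : option rat) : option rat :=
  let num := if z is Some x then M 0 0 * x + M 0 1 else M 0 0 in
  let den := if z is Some x then M 1 0 * x + M 1 1 else M 1 0 in
  if den == 0 then None else Some (num / den).

Definition triad_moebius (I J K I' J' K' : affine) : option rat -> option rat :=
  moebius (invmx (quot_mx (K' - I') (K' - J'))) \o
  moebius (quot_mx (K - I) (K - J)).

Definition involution (T : Type) (f : T -> T) : Prop :=
  involutive f /\ exists z : T, f z <> z.

(* Main.v *)
Require Import Defs.
From HB Require Import structures.
From mathcomp Require Import all_boot all_order all_algebra.
From mathcomp Require Import all_classical all_reals all_analysis.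
From mathcomp Require Import ring lra.

Set Implicit Arguments.
Unset Strict Implicit.
Unset Printing Implicit Defensive.

Import Order.TTheory GRing.Theory Num.Theory.
Import numFieldNormedType.Exports.

Local Open Scope classical_set_scope.
Local Open Scope ring_scope.

(** Near a regular X-point the functions Yi and Yj are two lines crossing above p.
To the right of p the upper one is I and the lower one J; to the left their roles
are exchanged, so I' = J and J' = I ([regular_swap]). By continuity of Y, the
lines K and K' meet above p, strictly above the crossing point ([triad_at]).

The homology is then studied through its action on the equations of lines. The
form of a non-vertical line takes the value - 1 at o_infty, hence lam carries the
forms of the triad to one another with one and the same factor c
([map_line_form]). Since lam exchanges I and J, the sum I + J is an eigenvector
for c and the difference I - J, which is a multiple of the equation of the
axis P, is an eigenvector for - c; likewise K + K' is an eigenvector for c,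
because K - K' is also a multiple of the equation of P. Therefore lam is c times
a reflection with axis P ([swap_homology_harmonic]), and for a reflection
harmonicity is the symmetry of y + s o and y - s o with respect to y and o
([reflection_harmonic]).

The definition of mu does not refer to lam, and the same relations between I, J, K
and K' are used directly: with Q and Q' the matrices of (K - I) / (K - J) and
(K' - I') / (K' - J'), one gets Q' = T Q with T T = 1, so that Q'^-1 Q has
square 1, and it is not scalar ([swap_moebius_involution]). *)

(** * Reflections are harmonic homologies *)

Lemma mx11_eq0 (M : 'M[rat]_1) : (M == 0) = (M 0 0 == 0).
Proof.
apply/eqP/eqP => [->|M0]; first by rewrite mxE.
by apply/matrixP => i j; rewrite !ord1 M0 mxE.
Qed.

Lemma reflection_unitmx (n : nat) (lam : 'M[rat]_n) (o : 'rV[rat]_n)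
    (h : 'cV[rat]_n) (c : rat) :
  c != 0 -> o *m h = 1%:M -> lam = c *: (1%:M - 2 *: (h *m o)) ->
  lam \in unitmx.
Proof.
move=> c0 oh ->.
have idem : (h *m o) *m (h *m o) = h *m o.
  by rewrite mulmxA -(mulmxA h) oh mulmx1.
have sq : (1%:M - 2 *: (h *m o)) *m (1%:M - 2 *: (h *m o)) = 1%:M.
  rewrite mulmxBl mul1mx mulmxBr mulmx1 -scalemxAl -scalemxAr idem scalerA.
  rewrite opprB -scalerBl; apply/matrixP => i j; rewrite !mxE; ring.
by rewrite unitmxZ ?unitfE //; case/mulmx1_unit: sq.
Qed.

(** The matrix 1 - 2 h o, with o h = 1, is the reflection that negates o and is
the identity on the kernel of h. *)
Lemma reflectionE (n : nat) (lam : 'M[rat]_n) (o : 'rV[rat]_n)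
    (h : 'cV[rat]_n) (c : rat) (x : 'rV[rat]_n) :
  lam = c *: (1%:M - 2 *: (h *m o)) ->
  x *m lam = c *: x - (2 * c * (x *m h) 0 0) *: o.
Proof.
move=> ->; rewrite -scalemxAr mulmxBr mulmx1 -scalemxAr mulmxA.
rewrite {1}[x *m h]mx11_scalar mul_scalar_mx.
by apply/rowP => i; rewrite !mxE; ring.
Qed.

(** The kernel of h is the eigenspace of c, and o is an eigenvector of - c. *)
Lemma reflection_homology (lam P : 'M[rat]_3) (o : 'rV[rat]_3)
    (h : 'cV[rat]_3) (c : rat) :
  c != 0 -> o *m h = 1%:M -> (P == kermx h)%MS ->
  lam = c *: (1%:M - 2 *: (h *m o)) -> homology lam P o.
Proof.
move=> c0 oh /eqmxP PE lamE.
have oh00 : (o *m h) 0 0 = 1 by rewrite oh mxE eqxx.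
have o0 : o != 0.
  by apply: contra_eq_neq oh00 => ->; rewrite mul0mx mxE eq_sym oner_eq0.
have h0 : h != 0.
  by apply: contra_eq_neq oh00 => ->; rewrite mulmx0 mxE eq_sym oner_eq0.
have rkP : \rank P = 2%N.
  by rewrite PE mxrank_ker -mxrank_tr rank_rV trmx_eq0 h0.
have actP (x : 'rV_3) : (x <= P)%MS -> x *m lam = c *: x.
  rewrite PE sub_kermx => /eqP xh.
  by rewrite (reflectionE x lamE) xh mxE mulr0 scale0r subr0.
have acto : o *m lam = - c *: o.
  by rewrite (reflectionE o lamE) oh00 -scalerBl; congr (_ *: _); ring.
have fixZ (x : 'rV[rat]_3) a : a != 0 -> x *m lam = a *: x -> fixes lam x.
  by move=> a0 xl; rewrite /fixes xl; apply/eqmxP/eqmx_scale.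
split=> //.
- split; first exact: reflection_unitmx c0 oh lamE.
  apply/negP => /is_scalar_mxP[a la].
  (* a scalar matrix would have both c and - c for its only eigenvalue *)
  have eigen (x : 'rV_3) b : x != 0 -> x *m lam = b *: x -> a = b.
    rewrite la mul_mx_scalar => x0 /eqP; rewrite -subr_eq0 -scalerBl.
    by rewrite scaler_eq0 (negPf x0) orbF subr_eq0 => /eqP.
  have r0 : nz_row P != 0 by rewrite nz_row_eq0 -mxrank_eq0 rkP.
  have ac := eigen _ _ r0 (actP _ (nz_row_sub P)).
  have aNc := eigen _ _ o0 acto.
  by move/eqP: c0; apply; lra.
- by move=> x _ xP; apply: (fixZ _ c c0); exact: actP.
- by split=> //; apply: (fixZ _ (- c)); rewrite ?oppr_eq0.
- by rewrite PE sub_kermx oh matrix_nonzero1.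
Qed.

(** Write x = y + s o, with y on the axis. Then x' = c (y - s o), so x and x' are
placed symmetrically with respect to y and o: this is harmonicity, and y is where
the line xx' meets the axis. *)
Lemma reflection_harmonic (lam P : 'M[rat]_3) (o : 'rV[rat]_3)
    (h : 'cV[rat]_3) (c : rat) :
  c != 0 -> o *m h = 1%:M -> (P == kermx h)%MS ->
  lam = c *: (1%:M - 2 *: (h *m o)) -> harmonic_homology lam P o.
Proof.
move=> c0 oh PE lamE; split; first exact: reflection_homology c0 oh PE lamE.
have inP (x : 'rV[rat]_3) : (x <= P)%MS = ((x *m h) 0 0 == 0).
  by rewrite (eqmxP PE) sub_kermx mx11_eq0.
move=> x x0 xo xP /=; rewrite (reflectionE x lamE).
set s := (x *m h) 0 0; set y := x - s *: o; set x' := _ - _.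
have s0 : s != 0 by rewrite inP in xP.
have xE : x = y + s *: o by rewrite subrK.
have y0 : y != 0.
  apply: contra xo => /eqP yz; apply/eqmxP; rewrite xE yz add0r.
  exact: eqmx_scale.
have yh : (y *m h) 0 0 = 0.
  by rewrite mulmxBl -scalemxAl oh mxE -/s !mxE mulr1 subrr.
have yE : y = 2^-1 *: x + (2 * c)^-1 *: x'.
  by apply/rowP => i; rewrite !mxE; field.
have oE : o = (2 * s)^-1 *: x + (- (2 * s * c)^-1) *: x'.
  by apply/rowP => i; rewrite !mxE; field; apply/andP.
(* a combination of x and x' lies on P only if its o-component vanishes *)
have ycap : (y == (x + x')%MS :&: P)%MS.
  apply/andP; split.
    rewrite sub_capmx inP yh eqxx andbT {1}yE.
    by rewrite addmx_sub // scalemx_sub // ?addsmxSl ?addsmxSr.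
  apply/rV_subP => z; rewrite sub_capmx => /andP[/sub_addsmxP[[u1 u2] /= zE]].
  rewrite [u1]mx11_scalar [u2]mx11_scalar !mul_scalar_mx in zE.
  move: zE; move: (u1 0 0) (u2 0 0) => a b zE.
  have x'E : x' = c *: y - (c * s) *: o.
    by apply/rowP => i; rewrite !mxE; ring.
  have zE' : z = (a + c * b) *: y + (s * (a - c * b)) *: o.
    by rewrite zE x'E; apply/rowP => i; rewrite !mxE; ring.
  rewrite zE' inP mulmxDl -!scalemxAl oh [y *m h]mx11_scalar yh !mxE.
  rewrite mul0rn mulr0 add0r mulr1.
  rewrite mulf_eq0 (negPf s0) /= => /eqP ->.
  by rewrite mulr0 scale0r addr0 scalemx_sub.
exists y; first exact: ycap.
split.
  apply/eqP; rewrite eqn_leq; apply/andP; split.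
    apply: leq_trans (mxrank_adds_leqif x x') _.
    by rewrite !rank_rV; case: (_ != 0); case: (_ != 0).
  suff : (\rank ((x + x')%MS :&: P)%MS < \rank (x + x')%MS)%N.
    by rewrite -(eqmxP ycap) rank_rV y0.
  apply: rank_ltmx; rewrite ltmxE capmxSl; apply: contra xP => capS.
  exact: submx_trans (addsmxSl x x') (submx_trans capS (capmxSr _ P)).
exists (2 * s)^-1, (- (2 * s * c)^-1), 2^-1, (2 * c)^-1; split=> //.
  by rewrite ?oppr_eq0 !invr_eq0 !mulf_neq0.
by field; apply/andP.
Qed.

(** * The collineation of a triad with exchanged lines *)

(** The line of equation x f = 0 is represented by the column f. Collineations act
linearly on these columns, and linear combinations of two of them describe the
lines of a pencil. *)
Definition line_form (A : affine) : 'cV[rat]_3 := (hpoint A.1 (-1) A.2)^T.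

Definition vertical_form (p : rat) : 'cV[rat]_3 := (hpoint 1 0 (- p))^T.

Lemma mul_hpoint_tr (x : 'rV[rat]_3) (a b c : rat) :
  (x *m (hpoint a b c)^T) 0 0
  = x 0 0 * a + x 0 1 * b + x 0 2%R * c.
Proof.
rewrite mxE !big_ord_recl big_ord0 !mxE /= addr0 addrA.
by do !congr (_ + _ * _); congr (x _ _); apply/val_inj.
Qed.

(** Two lines meeting above p span a pencil, which contains the vertical line
through p. *)
Lemma line_formB (A B : affine) (p : rat) : aff_rat A p = aff_rat B p ->
  line_form A - line_form B = (A.1 - B.1) *: vertical_form p.
Proof.
rewrite /aff_rat => AB; apply/matrixP => i j; rewrite !mxE.
by case: i => [[|[|[|//]]] lti] /=; lra.
Qed.

Lemma axis_ker (p y : rat) :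
  (hpoint p y 1 + o_infty == kermx (vertical_form p))%MS.
Proof.
have inK (x : 'rV[rat]_3) :
    (x <= kermx (vertical_form p))%MS = (x 0 0 == p * x 0 2%R).
  by rewrite sub_kermx mx11_eq0 mul_hpoint_tr; apply/eqP/eqP => xp; lra.
apply/andP; split; first by rewrite addsmx_sub !inK !mxE /= mulr1 mulr0 !eqxx.
apply/rV_subP => x; rewrite inK => /eqP xp.
apply/sub_addsmxP; exists ((x 0 2%R)%:M, (x 0 1 - x 0 2%R * y)%:M).
rewrite !mul_scalar_mx; apply/rowP => i; rewrite !mxE.
case: i => [[|[|[|//]]] lti] /=.
- by rewrite (_ : Ordinal lti = 0) ?xp; [ring|exact: val_inj].
- by rewrite (_ : Ordinal lti = 1); [ring|exact: val_inj].
- by rewrite (_ : Ordinal lti = 2%R); [ring|exact: val_inj].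
Qed.

(** The third form restricts x to the vertical line over p. On that line, the
bisector of I and J vanishes only at height I(p), and that of K and K' only at
the different height K(p). *)
Lemma line_forms_separate (I J K K' : affine) (p : rat) (x : 'rV[rat]_3) :
  aff_rat I p = aff_rat J p -> aff_rat K p = aff_rat K' p ->
  aff_rat I p != aff_rat K p ->
  x *m (line_form I + line_form J) = 0 ->
  x *m (line_form K + line_form K') = 0 -> x *m vertical_form p = 0 -> x = 0.
Proof.
rewrite /aff_rat => IJ KK IK xs xt xv.
have zero a b c : x *m (hpoint a b c)^T = 0 ->
    x 0 0 * a + x 0 1 * b + x 0 2%R * c = 0.
  by rewrite -mul_hpoint_tr => ->; rewrite mxE.
have formD A B : line_form A + line_form B
    = (hpoint (A.1 + B.1) (- 2) (A.2 + B.2))^T.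
  by apply/matrixP => i j; rewrite !mxE; case: i => [[|[|[|//]]] lti] /=; lra.
rewrite !formD in xs xt.
have e1 := zero _ _ _ xs; have e2 := zero _ _ _ xt; have e3 := zero _ _ _ xv.
have x0 : x 0 0 = p * x 0 2%R by lra.
have x2 : x 0 2%R * ((I.1 * p + I.2) - (K.1 * p + K.2)) = 0.
  rewrite x0 in e1 e2.
  have a1 : x 0 2%R * (I.1 * p + I.2) = x 0 1.
    have : x 0 2%R * (I.1 * p + I.2) = x 0 2%R * (J.1 * p + J.2) by rewrite IJ.
    lra.
  have a2 : x 0 2%R * (K.1 * p + K.2) = x 0 1.
    have : x 0 2%R * (K.1 * p + K.2) = x 0 2%R * (K'.1 * p + K'.2) by rewrite KK.
    lra.
  by rewrite mulrBr a1 a2 subrr.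
move/eqP: x2; rewrite mulf_eq0 (negPf (_ : _ - _ != 0)) ?subr_eq0 // orbF.
move=> /eqP x2.
have x00 : x 0 0 = 0 by rewrite x0 x2 mulr0.
have x1 : x 0 1 = 0 by rewrite x2 x00 in e1; lra.
apply/rowP => i; rewrite mxE.
case: i => [[|[|[|//]]] lti].
- by rewrite -[RHS]x00; congr (x _ _); exact: val_inj.
- by rewrite -[RHS]x1; congr (x _ _); exact: val_inj.
- by rewrite -[RHS]x2; congr (x _ _); exact: val_inj.
Qed.

(** The collineation pulls back the form of A' to a multiple of the form of A. The
multiple is the eigenvalue of o_infty, because all forms of graphs take the same
value - 1 at o_infty. Having the same multiple for all three lines of the triad
is what makes it possible to add and subtract the resulting equations. *)
Lemma map_line_form (A A' : affine) (lam : 'M[rat]_3) (c : rat) :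
  o_infty *m lam = c *: o_infty -> (graph A *m lam == graph A')%MS ->
  lam *m line_form A' = c *: line_form A.
Proof.
move=> lo /andP[sub _].
set f := lam *m line_form A'.
have fE (x : 'rV[rat]_3) : x *m line_form A = 0 -> x *m f = 0.
  move/sub_kermxP => xA; apply/eqP; rewrite /f mulmxA -sub_kermx.
  exact: submx_trans (submxMr _ xA) sub.
have dot (g : 'cV[rat]_3) x y z :
    (hpoint x y z *m g) 0 0 = x * g 0 0 + y * g 1 0 + z * g 2%R 0.
  rewrite mxE !big_ord_recl big_ord0 !mxE /= addr0 addrA.
  by do !congr (_ + _ * _); congr (g _ _); apply/val_inj.
have zero x y z : x * A.1 - y + z * A.2 = 0 ->
    x * f 0 0 + y * f 1 0 + z * f 2%R 0 = 0.
  move=> e; rewrite -dot fE ?mxE //; apply/eqP.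
  by rewrite mx11_eq0 mul_hpoint_tr !mxE /=; apply/eqP; lra.
(* f and c * line_form A agree at o_infty, which lies off the graph of A *)
have f1 : f 1 0 = - c.
  have := dot f 0 1 0; rewrite /f mulmxA -[hpoint 0 1 0]/o_infty lo -scalemxAl.
  by rewrite mxE mul_hpoint_tr !mxE /= => e; lra.
have e1 : f 0 0 = c * A.1.
  by have := zero 1 A.1 0 ltac:(lra); rewrite f1; lra.
have e2 : f 2%R 0 = c * A.2.
  by have := zero 0 A.2 1 ltac:(lra); rewrite f1; lra.
clearbody f.
apply/matrixP => i j; rewrite !mxE ord1.
case: i => [[|[|[|//]]] lti] /=.
- by rewrite -e1; congr (f _ _); exact: val_inj.
- by rewrite mulrN1 -f1; congr (f _ _); exact: val_inj.
- by rewrite -e2; congr (f _ _); exact: val_inj.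
Qed.

Lemma fixes_scale (lam : 'M[rat]_3) (x : 'rV[rat]_3) :
  lam \in unitmx -> x != 0 -> fixes lam x ->
  exists2 c, c != 0 & x *m lam = c *: x.
Proof.
move=> lamU x0 /andP[/sub_rVP[c xl] _]; exists c => //.
apply: contra x0 => /eqP c0; apply/eqP.
by rewrite -[x](mulmxK lamU) xl c0 scale0r mul0mx.
Qed.

(** Acting on forms, lam exchanges I and J up to the factor c. Hence it multiplies
I + J by c and the vertical form v, proportional to I - J, by - c. Since K - K'
is also a multiple of v, the form K + K' is multiplied by c. These three forms
are independent, so lam is c times a reflection. *)
Lemma swap_homology_harmonic (I J K K' : affine) (p : rat) (lam : 'M[rat]_3) :
  aff_rat I p = aff_rat J p -> I.1 != J.1 -> aff_rat K p = aff_rat K' p ->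
  aff_rat I p != aff_rat K p -> triad_homology I J K J I K' lam ->
  exists o, harmonic_homology lam (hpoint p (aff_rat I p) 1 + o_infty)%MS o.
Proof.
move=> IJ IJ1 KK IK [lamU fixo lI lJ lK].
have oi0 : o_infty != 0.
  apply/eqP => /rowP/(_ 1); rewrite !mxE /= => /eqP; exact/negP/oner_neq0.
have [c c0 lo] := fixes_scale lamU oi0 fixo.
have fI := map_line_form lo lI; have fJ := map_line_form lo lJ.
have fK := map_line_form lo lK.
set v := vertical_form p.
have lv : lam *m v = - c *: v.
  have IJ0 : I.1 - J.1 != 0 by rewrite subr_eq0.
  apply: (scalerI IJ0); rewrite scalemxAr [RHS]scalerA mulrC -[RHS]scalerA.
  rewrite -(line_formB IJ) mulmxBr fI fJ.
  by apply/matrixP => i j; rewrite !mxE; ring.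
have lIJ : lam *m (line_form I + line_form J)
    = c *: (line_form I + line_form J).
  by rewrite mulmxDr fI fJ -scalerDr addrC.
(* K = K' + (K - K'), where K - K' is a multiple of v, which lam negates *)
have lKK : lam *m (line_form K + line_form K')
    = c *: (line_form K + line_form K').
  rewrite -{1}(subrK (line_form K') (line_form K)) -addrA mulmxDr.
  rewrite (line_formB KK) -scalemxAr lv mulmxDr fK.
  rewrite scalerA mulrN mulrC -mulNr -scalerA -(line_formB KK).
  by apply/matrixP => i j; rewrite !mxE; ring.
(* lam = c (1 - 2 v o) forces y - c^-1 (y lam) = 2 (y v) o for every y; this is
   solved for o with a y such that y v = 1 *)
set y := hpoint 1 0 0; set o := 2^-1 *: (y - c^-1 *: (y *m lam)).
have ov : o *m v = 1%:M.
  have yv : y *m v = 1%:M.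
    by rewrite [LHS]mx11_scalar mul_hpoint_tr !mxE /=; congr (_%:M); ring.
  rewrite -scalemxAl mulmxBl -scalemxAl -mulmxA lv -scalemxAr scalerA yv.
  by apply/matrixP => i j; rewrite !mxE; field.
have o_ker f : lam *m f = c *: f -> o *m f = 0.
  move=> lf; rewrite -scalemxAl mulmxBl -scalemxAl -mulmxA lf -scalemxAr scalerA.
  by rewrite mulVf // scale1r subrr scaler0.
exists o; apply: (reflection_harmonic c0 ov (axis_ker p _)).
apply/eqP; rewrite -subr_eq0; apply/eqP/row_matrixP => i; rewrite row0.
have lo_v f : (lam - c *: (1%:M - 2 *: (v *m o))) *m f
    = lam *m f - c *: f + (2 * c) *: (v *m (o *m f)).
  rewrite mulmxBl -scalemxAl mulmxBl mul1mx -scalemxAl -mulmxA.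
  by apply/matrixP => a b; rewrite !mxE; ring.
apply: (line_forms_separate IJ KK IK); rewrite -row_mul lo_v.
- by rewrite lIJ o_ker // mulmx0 subrr scaler0 addr0 row0.
- by rewrite lKK o_ker // mulmx0 subrr scaler0 addr0 row0.
- rewrite lv ov mulmx1; apply/rowP => a; rewrite !mxE; ring.
Qed.

(** * The associated Moebius transformation *)

Lemma mulmx22E (M N : 'M[rat]_2) i j :
  (M *m N) i j = M i 0 * N 0 j + M i 1 * N 1 j.
Proof.
rewrite mxE !big_ord_recl big_ord0 addr0.
by congr (_ + _); congr (M _ _ * N _ _); exact: val_inj.
Qed.

Lemma matrix22P (M N : 'M[rat]_2) :
  M 0 0 = N 0 0 -> M 0 1 = N 0 1 -> M 1 0 = N 1 0 -> M 1 1 = N 1 1 -> M = N.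
Proof.
move=> e00 e01 e10 e11; apply/matrixP => i j.
have ord2 (k : 'I_2) : k = 0 \/ k = 1.
  by case: k => [[|[|//]] ltk]; [left|right]; exact: val_inj.
by case: (ord2 i) => ->; case: (ord2 j) => ->.
Qed.

(** The point of the projective line with homogeneous coordinates (n, d). *)
Definition ratio (n d : rat) : option rat :=
  if d == 0 then None else Some (n / d).

Lemma moebius_ratio (M : 'M[rat]_2) (n d : rat) : (n != 0) || (d != 0) ->
  moebius M (ratio n d) = ratio (M 0 0 * n + M 0 1 * d) (M 1 0 * n + M 1 1 * d).
Proof.
rewrite /ratio /moebius; case: (eqVneq d 0) => [-> /[!orbF] n0|d0 _] /=.
  rewrite !mulr0 !addr0 mulf_eq0 (negPf n0) orbF; case: eqVneq => // m0.
  by congr Some; field; rewrite n0.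
have -> : M 1 0 * n + M 1 1 * d = (M 1 0 * (n / d) + M 1 1) * d by field.
rewrite mulf_eq0 (negPf d0) orbF; case: eqVneq => // m0.
have -> : M 0 0 * n + M 0 1 * d = (M 0 0 * (n / d) + M 0 1) * d by field.
by congr Some; rewrite -mulf_div divff // mulr1.
Qed.

Lemma ratio_surj (z : option rat) :
  exists n d, (n != 0) || (d != 0) /\ z = ratio n d.
Proof.
case: z => [x|]; last by exists 1, 0; rewrite /ratio eqxx oner_eq0.
by exists x, 1; rewrite /ratio oner_eq0 divr1 orbT.
Qed.

(** Invertibility of N keeps the homogeneous coordinates of the intermediate point
from vanishing simultaneously. *)
Lemma moebius_comp (M N : 'M[rat]_2) :
  N \in unitmx -> moebius M \o moebius N =1 moebius (M *m N).
Proof.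
move=> NU z /=; have [n [d [nd ->]]] := ratio_surj z.
have nd' : (N 0 0 * n + N 0 1 * d != 0) || (N 1 0 * n + N 1 1 * d != 0).
  rewrite -negb_and; apply/negP => /andP[/eqP e0 /eqP e1].
  have NK := mulVmx NU; move: nd; rewrite -negb_and => /negP; apply.
  have entry i : (invmx N *m N) i 0 * n + (invmx N *m N) i 1 * d = 0.
    rewrite !mulmx22E -[RHS](mulr0 (invmx N i 0)) -e0.
    by rewrite -[LHS]subr0 -(mulr0 (invmx N i 1)) -e1; ring.
  have := entry 0; have := entry 1; rewrite NK !mxE /= => en ed.
  by apply/andP; split; apply/eqP; lra.
rewrite !moebius_ratio // !mulmx22E; congr ratio; ring.
Qed.

Lemma moebius1 : moebius 1%:M =1 id.
Proof.
move=> z; have [n [d [nd ->]]] := ratio_surj z.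
by rewrite moebius_ratio // !mxE /= !mulr1n !mulr0n !mul1r !mul0r addr0 add0r.
Qed.

(** Three points determine a Moebius map: here infinity, 0 and 1. *)
Lemma moebius_id_scalar (M : 'M[rat]_2) : moebius M =1 id -> is_scalar_mx M.
Proof.
move=> Mid; have := Mid None; have := Mid (Some 0); have := Mid (Some 1).
rewrite /moebius !mulr0 !mulr1 !add0r.
case: eqP => // d1 [e1]; case: eqP => // d0 [e0]; case: eqP => // M10 _.
have M01 : M 0 1 = 0.
  by rewrite -[LHS](divfK (introN eqP d0)) e0 mul0r.
have M00 : M 0 0 = M 1 1.
  have := congr1 (fun x => x * (M 1 0 + M 1 1)) e1.
  by rewrite divfK ?mul1r ?M01 ?M10 ?add0r ?addr0 //; exact/eqP.
apply/is_scalar_mxP; exists (M 1 1).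
by apply: matrix22P; rewrite !mxE.
Qed.

(** The determinant is the difference of the slopes times the common value at
p. *)
Lemma quot_mx_unit (A B : affine) (p : rat) :
  aff_rat A p = aff_rat B p -> aff_rat A p != 0 -> A.1 != B.1 ->
  quot_mx A B \in unitmx.
Proof.
rewrite /aff_rat => AB A0 AB1.
rewrite unitmxE unitfE (expand_det_row _ 0) !big_ord_recl big_ord0.
rewrite /cofactor !det_mx11 !mxE /= expr0 expr1 mul1r addr0 mulN1r mulrN.
have -> : A.1 * B.2 - A.2 * B.1 = (A.1 - B.1) * (A.1 * p + A.2).
  have -> : B.2 = A.1 * p + A.2 - B.1 * p by lra.
  ring.
by rewrite mulf_neq0 // subr_eq0.
Qed.

(** The swap turns K - I, K - J into K' - J, K' - I. As K' - K = - r (I - J) for a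
rational r, both K' - J and K' - I are combinations of K - I and K - J, with a
coefficient matrix T that depends on r only and has square 1. So Q' = T Q, and
the matrix Q'^-1 Q of mu is conjugate to T. *)
Lemma swap_moebius_involution (I J K K' : affine) (p : rat) :
  aff_rat I p = aff_rat J p -> I.1 != J.1 -> aff_rat K p = aff_rat K' p ->
  aff_rat I p != aff_rat K p -> involution (triad_moebius I J K J I K').
Proof.
move=> IJ IJ1 KK IK; rewrite /triad_moebius.
set Q := quot_mx (K - I) (K - J); set Q' := quot_mx (K' - J) (K' - I).
have affB A B : aff_rat (A - B) p = aff_rat A p - aff_rat B p.
  by rewrite /aff_rat /=; ring.
have QU : Q \in unitmx.
  apply: (@quot_mx_unit _ _ p); rewrite ?affB ?IJ //.
    by rewrite -IJ subr_eq0 eq_sym.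
  by apply: contra IJ1 => /eqP /= e; apply/eqP; lra.
have Q'U : Q' \in unitmx.
  apply: (@quot_mx_unit _ _ p); rewrite ?affB ?IJ //.
    by rewrite -IJ -KK subr_eq0 eq_sym.
  by apply: contra IJ1 => /eqP /= e; apply/eqP; lra.
have muE : moebius (invmx Q') \o moebius Q =1 moebius (invmx Q' *m Q).
  exact: moebius_comp.
have s0 : I.1 - J.1 != 0 by rewrite subr_eq0.
pose r := (K.1 - K'.1) / (I.1 - J.1).
pose T : 'M[rat]_2 := \matrix_(i, j)
  (if i == 0 then if j == 0 then r else 1 - r
   else if j == 0 then 1 + r else - r).
have TT : T *m T = 1%:M.
  by apply: matrix22P; rewrite mulmx22E !mxE /=; ring.
have Q'E : Q' = T *m Q.
  rewrite /aff_rat in IJ KK.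
  have I2 : I.2 = J.1 * p + J.2 - I.1 * p by lra.
  have K2 : K'.2 = K.1 * p + K.2 - K'.1 * p by lra.
  by apply: matrix22P; rewrite mulmx22E !mxE /= ?I2 ?K2 /r; field.
have sq : (invmx Q' *m Q) *m (invmx Q' *m Q) = 1%:M.
  have -> : Q = T *m Q' by rewrite Q'E mulmxA TT mul1mx.
  rewrite !mulmxA mulmxK // -(mulmxA _ T T) TT mulmx1 mulVmx //.
split.
  move=> z; rewrite !muE.
  rewrite -[LHS]/((moebius _ \o moebius _) z) moebius_comp ?sq ?moebius1 //.
  by rewrite unitmx_mul unitmx_inv Q'U.
apply: contrapT => /forallNP nofix.
have /moebius_id_scalar/is_scalar_mxP[a Ma] : moebius (invmx Q' *m Q) =1 id.
  by move=> z; rewrite -muE; apply: contrapT; exact: nofix.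
(* the four differences all take the value K(p) - I(p) at p, so a = 1; then
   K - I = K' - J and K - J = K' - I force equal slopes of I and J *)
have QE : Q = a *: Q' by rewrite -(mulKVmx Q'U Q) Ma mul_mx_scalar.
have entry i j : Q i j = a * Q' i j by rewrite QE mxE.
have := entry 0 0; have := entry 0 1; have := entry 1 0; rewrite !mxE /=.
move=> e10 e01 e00.
have : aff_rat (K - I) p = a * aff_rat (K' - J) p.
  by rewrite /aff_rat /= e00 e01; ring.
rewrite !affB -IJ -KK => /eqP.
rewrite -subr_eq0 -{1}[X in X - _]mul1r -mulrBl mulf_eq0 subr_eq0.
rewrite [X in _ || X]subr_eq0 [X in _ || X]eq_sym (negPf IK) orbF => /eqP a1.
by move: e00 e10; rewrite -a1 !mul1r => e00 e10; move/eqP: IJ1; apply; lra.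
Qed.

(** * The triad near a regular X-point *)

Lemma aff_real_ratr (R : realType) (A : affine) (q : rat) :
  aff_real A (ratr q : R) = ratr (aff_rat A q).
Proof. by rewrite /aff_real /aff_rat rmorphD rmorphM. Qed.

Lemma aff_real_inj (R : realType) (A B : affine) (x y : R) : x != y ->
  aff_real A x = aff_real B x -> aff_real A y = aff_real B y -> A = B.
Proof.
rewrite /aff_real => xy Ax Ay.
have e1 : (ratr A.1 - ratr B.1) * (x - y) = 0 :> R by lra.
move/eqP: e1; rewrite mulf_eq0 !subr_eq0 (negPf xy) orbF => /eqP e1.
have e2 : ratr A.2 = ratr B.2 :> R by rewrite e1 in Ax; lra.
rewrite [A]surjective_pairing [B]surjective_pairing.
by rewrite (fmorph_inj _ e1) (fmorph_inj _ e2).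
Qed.

Lemma aff_real_right_inj (R : realType) (A B : affine) (p : R) :
  (\forall x \near p^'+, aff_real A x = aff_real B x) -> A = B.
Proof.
case=> e /= e0 AB; apply: (@aff_real_inj R _ _ (p + e / 2) (p + e / 3)).
- by apply/eqP; lra.
- by apply: AB; rewrite /= ?ltr_norml; lra.
- by apply: AB; rewrite /= ?ltr_norml; lra.
Qed.

Lemma aff_real_left_inj (R : realType) (A B : affine) (p : R) :
  (\forall x \near p^'-, aff_real A x = aff_real B x) -> A = B.
Proof.
case=> e /= e0 AB; apply: (@aff_real_inj R _ _ (p - e / 2) (p - e / 3)).
- by apply/eqP; lra.
- by apply: AB; rewrite /= ?ltr_norml; lra.
- by apply: AB; rewrite /= ?ltr_norml; lra.
Qed.

Lemma continuous_aff_real (R : realType) (A : affine) :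
  continuous (@aff_real R A).
Proof.
move=> x; apply: cvgD; last exact: cvg_cst.
by apply: cvgM; [exact: cvg_cst | exact: cvg_id].
Qed.

Lemma continuous_left_value (R : realType) (f g : R -> R) (p : R) :
  {for p, continuous f} -> {for p, continuous g} ->
  (\forall x \near p^'-, f x = g x) -> f p = g p.
Proof.
move=> fp gp fg.
have fl : f x @[x --> p^'-] --> f p by exact: cvg_at_left_filter.
have gl : g x @[x --> p^'-] --> g p by exact: cvg_at_left_filter.
apply: (cvg_unique _ fl); first exact: Rhausdorff.
by apply: cvg_trans gl; apply: near_eq_cvg; apply: filterS fg => x ->.
Qed.

Lemma Xpoint_eq (R : realType) (Yi Yj : R -> R) (p : rat) :
  Xpoint Yi Yj p -> Yi (ratr p) = Yj (ratr p).
Proof.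
case=> e e0 /seteqP[_ /(_ (ratr p) erefl)].
by case=> _ [].
Qed.

(** The coincidence set in an X-point is restricted to rational abscissae, so a
rational number close to p, different from p, is needed. *)
Lemma Xpoint_neq (R : realType) (Yi Yj : R -> R) (p : rat) :
  Xpoint Yi Yj p -> ~ (\forall x \near (ratr p : R), Yi x = Yj x).
Proof.
case=> e e0 /seteqP[isol _] [d /= d0 YE].
have : ratr p < ratr p + Num.min e d :> R by rewrite ltrDl lt_min e0.
move=> /rat_in_itvoo[q]; rewrite in_itv /= => /andP[pq].
rewrite -ltrBlDl lt_min => /andP[qe qd].
have : [set ratr p] (ratr q : R).
  apply: isol; split.
    by rewrite /= in_itv /=; lra.
  split; first by exists q.
  by apply: YE; rewrite /= ltr_norml; lra.
by move=> /= qp; move: pq; rewrite qp ltxx.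
Qed.

Lemma triad_near_right (R : realType) (Yi Yj Y : R -> R) (p : rat)
    (I J K I' J' K' : affine) :
  triad_near Yi Yj Y p I J K I' J' K' ->
  \forall x \near (ratr p : R)^'+,
    [/\ (Yi \max Yj) x = aff_real I x, (Yi \min Yj) x = aff_real J x
      & Y x = aff_real K x].
Proof.
move=> tri; near=> x.
have xp : ratr p < x by near: x; exact: nbhs_right_gt.
apply: (_ : ratr p <= x -> _) (ltW xp).
by near: x; apply: cvg_within; apply: filterS tri => x [].
Unshelve. all: by end_near.
Qed.

Lemma triad_near_left (R : realType) (Yi Yj Y : R -> R) (p : rat)
    (I J K I' J' K' : affine) :
  triad_near Yi Yj Y p I J K I' J' K' ->
  \forall x \near (ratr p : R)^'-,
    [/\ (Yi \max Yj) x = aff_real I' x, (Yi \min Yj) x = aff_real J' x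
      & Y x = aff_real K' x].
Proof.
move=> tri; near=> x.
have xp : x < ratr p by near: x; exact: nbhs_left_lt.
apply: (_ : x < ratr p -> _) xp.
by near: x; apply: cvg_within; apply: filterS tri => x [].
Unshelve. all: by end_near.
Qed.

(** The maximum and the minimum of two lines that cross at p follow opposite lines
on the two sides of p. *)
Lemma crossing_triad (R : realType) (Yi Yj Y : R -> R) (p : rat)
    (I J K I' J' K' A B : affine) :
  triad_near Yi Yj Y p I J K I' J' K' ->
  (\forall x \near (ratr p : R), Yi x = aff_real A x) ->
  (\forall x \near (ratr p : R), Yj x = aff_real B x) ->
  aff_rat A p = aff_rat B p -> A.1 < B.1 ->
  [/\ I = B, J = A, I' = A & J' = B].
Proof.
move=> tri YA YB AB AB1.
have AB1R : ratr A.1 < ratr B.1 :> R by rewrite ltr_rat.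
have ABp : aff_real A (ratr p : R) = aff_real B (ratr p).
  by rewrite !aff_real_ratr AB.
have ABx (x : R) : aff_real B x - aff_real A x
    = (ratr B.1 - ratr A.1) * (x - ratr p).
  by rewrite /aff_real in ABp *; lra.
have right : \forall x \near (ratr p : R)^'+,
    aff_real I x = aff_real B x /\ aff_real J x = aff_real A x.
  near=> x.
  have xp : ratr p < x by near: x; exact: nbhs_right_gt.
  have lt : aff_real A x < aff_real B x.
    by rewrite -subr_gt0 ABx mulr_gt0 // subr_gt0.
  have [<- <- _] : [/\ (Yi \max Yj) x = aff_real I x,
      (Yi \min Yj) x = aff_real J x & Y x = aff_real K x].
    by near: x; exact: triad_near_right tri.
  have Ax : Yi x = aff_real A x by near: x; apply: cvg_within.
  have Bx : Yj x = aff_real B x by near: x; apply: cvg_within.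
  by rewrite /= Ax Bx max_r ?min_l ?ltW.
have left : \forall x \near (ratr p : R)^'-,
    aff_real I' x = aff_real A x /\ aff_real J' x = aff_real B x.
  near=> x.
  have xp : x < ratr p by near: x; exact: nbhs_left_lt.
  have lt : aff_real B x < aff_real A x.
    by rewrite -subr_lt0 ABx nmulr_llt0 // ?subr_lt0 ?subr_gt0.
  have [<- <- _] : [/\ (Yi \max Yj) x = aff_real I' x,
      (Yi \min Yj) x = aff_real J' x & Y x = aff_real K' x].
    by near: x; exact: triad_near_left tri.
  have Ax : Yi x = aff_real A x by near: x; apply: cvg_within.
  have Bx : Yj x = aff_real B x by near: x; apply: cvg_within.
  by rewrite /= Ax Bx max_l ?min_r ?ltW.
split.
- by apply: (@aff_real_right_inj R _ _ (ratr p)); apply: filterS right => x [].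
- by apply: (@aff_real_right_inj R _ _ (ratr p)); apply: filterS right => x [].
- by apply: (@aff_real_left_inj R _ _ (ratr p)); apply: filterS left => x [].
- by apply: (@aff_real_left_inj R _ _ (ratr p)); apply: filterS left => x [].
Unshelve. all: by end_near.
Qed.

Lemma triad_nearC (R : realType) (Yi Yj Y : R -> R) (p : rat)
    (I J K I' J' K' : affine) :
  triad_near Yi Yj Y p I J K I' J' K' -> triad_near Yj Yi Y p I J K I' J' K'.
Proof.
apply: filterS => x /=; rewrite maxC minC; exact.
Qed.

(** The slopes at p differ: two lines with equal slopes through the same point
coincide, and the coincidence at p would not be isolated. Hence the lines
cross. *)
Lemma regular_swap (R : realType) (Yi Yj Y : R -> R) (p : rat)
    (I J K I' J' K' : affine) :
  Xpoint Yi Yj p -> triad_near Yi Yj Y p I J K I' J' K' ->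
  Xpoint_regular Yi Yj p -> [/\ I' = J, J' = I & I.1 != J.1].
Proof.
move=> X tri [[A YA] [B YB]].
have AB : aff_rat A p = aff_rat B p.
  suff : ratr (aff_rat A p) = ratr (aff_rat B p) :> R by move/fmorph_inj.
  rewrite -!aff_real_ratr.
  by rewrite -(nbhs_singleton YA) -(nbhs_singleton YB); exact: Xpoint_eq.
case: (ltgtP A.1 B.1) => AB1.
- have [-> -> -> ->] := crossing_triad tri YA YB AB AB1.
  by split=> //; rewrite gt_eqF.
- have [-> -> -> ->] := crossing_triad (triad_nearC tri) YB YA (esym AB) AB1.
  by split=> //; rewrite gt_eqF.
- have AB2 : A = B.
    rewrite [A]surjective_pairing [B]surjective_pairing AB1; congr pair.
    by move: AB; rewrite /aff_rat AB1; lra.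
  case: (Xpoint_neq X); near=> x.
  have -> : Yi x = aff_real A x by near: x.
  by rewrite AB2; apply: esym; near: x.
Unshelve. all: by end_near.
Qed.

(** The triad prescribes Y = K' only for x < p; continuity of Y extends the
equality to p. *)
Lemma triad_at (R : realType) (Yi Yj Y : R -> R) (p : rat)
    (I J K I' J' K' : affine) :
  Xpoint Yi Yj p -> auxiliary Yi Y p ->
  triad_near Yi Yj Y p I J K I' J' K' ->
  [/\ aff_rat I p = aff_rat J p, aff_rat K p = aff_rat K' p
    & aff_rat I p < aff_rat K p].
Proof.
move=> X [[Yc _] YiY] tri.
have Yeq := Xpoint_eq X.
have [/(_ (lexx _))[] /= + + + _] := nbhs_singleton tri.
rewrite -Yeq maxxx minxx !aff_real_ratr => Ip Jp Kp.
have K'p : Y (ratr p) = ratr (aff_rat K' p).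
  rewrite -aff_real_ratr; apply: continuous_left_value (Yc _) _ _.
    exact: continuous_aff_real.
  by apply: filterS (triad_near_left tri) => x [].
split.
- by move: Jp; rewrite Ip => /fmorph_inj.
- by move: K'p; rewrite Kp => /fmorph_inj.
- by rewrite -(ltr_rat R) -Ip -Kp.
Qed.

(** * Harmonicity and involution at regular X-points *)

Theorem corollary5 (R : realType) (Yi Yj Y : R -> R) (p : rat)
    (I J K I' J' K' : affine) (lam : 'M[rat]_3)
    (hYi : piecewise_affine Yi) (hYj : piecewise_affine Yj)
    (hp : Xpoint Yi Yj p) (hY : auxiliary Yi Y p)
    (hOmega : triad_near Yi Yj Y p I J K I' J' K')
    (hlam : triad_homology I J K I' J' K' lam)
    (hreg : Xpoint_regular Yi Yj p) :
  (exists o : 'rV[rat]_3,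
     harmonic_homology lam (hpoint p (aff_rat I p) 1 + o_infty)%MS o) /\
  involution (triad_moebius I J K I' J' K').
Proof.
have [I'E J'E IJ1] := regular_swap hp hOmega hreg.
have [IJ KK IK] := triad_at hp hY hOmega.
have IK0 : aff_rat I p != aff_rat K p by rewrite lt_eqF.
subst I' J'; split.
  exact: swap_homology_harmonic IJ IJ1 KK IK0 hlam.
exact: swap_moebius_involution IJ IJ1 KK IK0.
Qed.
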